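(* Consider the system $$\begin{cases} C'= \lambda_7 R -(\varepsilon+\beta_1+\lambda_5) C + (\lambda_1+m\lambda_4) P_C+\lambda_2RP_C\\ R'= \lambda_5 C-(\varepsilon+\beta_2+\lambda_7)R + (\lambda_3+m\lambda_4) P_R +(\lambda_2+m_R\lambda_6)RP_R\\ P_C'=(1-\alpha)\gamma + \beta_1 C+ \lambda_7 P_R - (\varepsilon+\lambda_5+\lambda_1+m\lambda_4) P_C - \lambda_2RP_C \\ P_R'=\alpha \gamma + \beta_2 R + \lambda_5 P_C - (\varepsilon+\lambda_7+\lambda_3+m\lambda_4) P_R - (\lambda_2+m_R\lambda_6) RP_R \end{cases}$$ with $\varepsilon>0$, $\lambda_2>0$, $\lambda_3+m\lambda_4\ne 0$, $\lambda_1+m\lambda_4\ne 0$ and $\lambda_5=\lambda_7=0$. Then there is a unique equilibrium solution $(R^*,C^*,P_R^*,P_C^* )$; it is locally asymptotically stable and is given by $$R^*=\frac{\alpha\gamma}{2\varepsilon}-\theta+\sqrt{\left(\frac{\alpha\gamma}{2\varepsilon}+\theta\right)^2-\frac{\alpha\gamma(\varepsilon+\beta_2)}{\varepsilon(\lambda_2+m_R\lambda_6)}},$$ $$C^*=\frac{(1-\alpha)\gamma(\lambda_1+m\lambda_4+\lambda_2R^* )}{\varepsilon(\varepsilon+\beta_1+\lambda_1+m\lambda_4+\lambda_2R^* )},$$ $$P_R^*=\frac{\gamma\alpha}{\varepsilon}-R^*,\qquad P_C^*=\frac{\gamma(1-\alpha)}{\varepsilon}-C^*,$$ where $$\theta=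\frac{\lambda_3+m\lambda_4+\beta_2+\varepsilon}{2(\lambda_2+m_R\lambda_6)}.$$
   Context: The parameters $\lambda_1,\dots,\lambda_7,\beta_1,\beta_2,\varepsilon,\gamma,m,m_R$ are nonnegative real constants and $\alpha\in[0,1]$. An equilibrium solution is a constant solution with nonnegative components; here it is listed in the order $(R^*,C^*,P_R^*,P_C^* )$, where $R^*,C^*,P_R^*,P_C^*$ are the constant values of $R,C,P_R,P_C$. *)

(* Defs.v *)
From Stdlib Require Import Reals.
From Coquelicot Require Import Coquelicot.
Open Scope R_scope.

(* [x] solves x' = F x on [0, T), T possibly infinite.  Right-continuity at 0
   makes x 0 the initial value; values of [x] outside [0, T) are irrelevant. *)
Definition is_solution {V : NormedModule R_AbsRing} (F : V -> V)
    (T : Rbar) (x : R -> V) : Prop :=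
  filterlim x (at_right 0) (locally (x 0)) /\
  forall t : R, 0 < t -> Rbar_lt t T -> is_derive x t (F (x t)).

(* Quantifying over solutions on every [0, T), not only on [0, +oo), excludes
   finite-time blow-up of solutions that start near [s] when F is locally
   Lipschitz.  Perturbations range over a full neighbourhood of [s] in V. *)
Definition lyapunov_stable {V : NormedModule R_AbsRing} (F : V -> V)
    (s : V) : Prop :=
  forall eta : R, 0 < eta ->
  exists delta : R, 0 < delta /\
  forall (T : Rbar) (x : R -> V),
    is_solution F T x -> norm (minus (x 0) s) < delta ->
    forall t : R, 0 <= t -> Rbar_lt t T -> norm (minus (x t) s) < eta.

(* For a locally Lipschitz F and a Lyapunov stable [s], every solution starting
   close enough to [s] extends to [0, +oo), so global solutions suffice here. *)
Definition locally_attractive {V : NormedModule R_AbsRing} (F : V -> V)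
    (s : V) : Prop :=
  exists delta : R, 0 < delta /\
  forall x : R -> V,
    is_solution F p_infty x -> norm (minus (x 0) s) < delta ->
    filterlim x (Rbar_locally p_infty) (locally s).

Definition locally_asymptotically_stable {V : NormedModule R_AbsRing}
    (F : V -> V) (s : V) : Prop :=
  lyapunov_stable F s /\ locally_attractive F s.

(* States are listed in the order (R, C, P_R, P_C). *)
Definition state : Type := R * R * R * R.

Definition nonneg_state (s : state) : Prop :=
  let '(r, c, pr, pc) := s in 0 <= r /\ 0 <= c /\ 0 <= pr /\ 0 <= pc.

Definition vector_field
    (lambda1 lambda2 lambda3 lambda4 lambda5 lambda6 lambda7
     beta1 beta2 epsilon gamma m mR alpha : R) (s : state) : state :=
  let '(r, c, pr, pc) := s in
  let dc :=
    lambda7 * r - (epsilon + beta1 + lambda5) * c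
    + (lambda1 + m * lambda4) * pc + lambda2 * r * pc in
  let dr :=
    lambda5 * c - (epsilon + beta2 + lambda7) * r
    + (lambda3 + m * lambda4) * pr + (lambda2 + mR * lambda6) * r * pr in
  let dpc :=
    (1 - alpha) * gamma + beta1 * c + lambda7 * pr
    - (epsilon + lambda5 + lambda1 + m * lambda4) * pc - lambda2 * r * pc in
  let dpr :=
    alpha * gamma + beta2 * r + lambda5 * pc
    - (epsilon + lambda7 + lambda3 + m * lambda4) * pr
    - (lambda2 + mR * lambda6) * r * pr in
  (dr, dc, dpr, dpc).

Definition equilibrium (F : state -> state) (s : state) : Prop :=
  is_solution F p_infty (fun _ : R => s) /\ nonneg_state s.

(* Main.v *)
Require Import Defs.
From Stdlib Require Import Reals Lra.
From Coquelicot Require Import Coquelicot.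
Open Scope R_scope.

(** With [lambda5 = lambda7 = 0] the two totals [U = R + P_R] and
    [W = C + P_C] obey [U' = alpha gamma - epsilon U] and
    [W' = (1 - alpha) gamma - epsilon W], so they relax to
    [u0 = alpha gamma / epsilon] and [w0 = (1 - alpha) gamma / epsilon]
    whatever the rest of the state does.  Write [a = lambda3 + m lambda4]
    and [b = lambda2 + mR lambda6].

    Equilibria.  Setting [P_R = u0 - R] turns [R' = 0] into a quadratic
    equation for [R] alone, [(a + b R) (u0 - R) = (epsilon + beta2) R].  The
    concave difference of its two sides is [a u0 >= 0] at [0] and nonpositive
    at [u0], so its larger root lies in [[0, u0]]; its smaller root is
    negative, because the product of the roots is [- a u0 / b] and, if
    [u0 = 0], their sum is [- (a + epsilon + beta2) / b]
    ([nonneg_root_characterization]).  Given [R >= 0], the equation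
    [C' = 0] with [P_C = w0 - C] is linear in [C] with negative slope.

    Stability.  In the deviations [x] of [R], [y] of [C], [v] of [U] and [w]
    of [W] the system is a cascade
<<
      v' = - epsilon v,                  w' = - epsilon w,
      x' = - k x + p v + b x (v - x),
      y' = - K y + G w + q x + l x (w - y),
>>
    in which [k], minus the slope of the quadratic at its larger root, and [K]
    are positive.  In such a cascade the linear coupling terms are dominated by
    weighting the upstream squares heavily enough, and the quadratic terms are
    dominated near the origin.  Hence a form [L = y^2 + A x^2 + B v^2 + D w^2]
    satisfies [L' <= - c L] on a sublevel set [L <= rho]
    ([cascade_quadratic_decay]).  A solution starting below that level stays
    below it, since [L] would first have to increase up to the level [rho]; so [L]
    decays exponentially along it ([lyapunov_exponential]), which gives both
    stability and attraction. *)

(** * Differential inequalities on a half-open interval *)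

(** Only the right limit of [f] at [0] is known, so the mean value theorem is
    applied on [[e, s]] for a small [e > 0] at which [f e] is still below
    [f s]. *)
Lemma nonincreasing_from_right_limit (f : R -> R) (s : R) :
  0 < s ->
  filterlim f (at_right 0) (locally (f 0)) ->
  (forall t, 0 < t <= s -> ex_derive f t) ->
  (forall t, 0 < t < s -> Derive f t <= 0) ->
  f s <= f 0.
Proof.
intros Hs Hlim Hex Hneg.
destruct (Rle_lt_dec (f s) (f 0)) as [H|H]; [exact H|exfalso].
assert (Hnear : at_right 0 (fun e => f e < f s)).
{ apply (Hlim (fun v => v < f s)). apply (open_lt (f s)). exact H. }
assert (Hbelow : at_right 0 (fun e => e < s)).
{ apply filter_le_within. apply (open_lt s). exact Hs. }
assert (Hpos : at_right 0 (fun e => 0 < e)).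
{ exists (mkposreal 1 Rlt_0_1). intros y _ Hy. exact Hy. }
destruct (filter_ex _ (filter_and _ _ Hnear (filter_and _ _ Hbelow Hpos)))
  as [e [He1 [He2 He3]]].
destruct (MVT_cor2 f (Derive f) e s He2) as [c [Heq Hc]].
- intros t Ht. apply is_derive_Reals, Derive_correct, Hex. lra.
- assert (Derive f c <= 0) by (apply Hneg; lra). nra.
Qed.

(** At the first time where [f] reaches [rho] it would have been nonincreasing
    ever since [0], hence would still be at most [f 0 < rho]. *)
Lemma trapped_below_level (f : R -> R) (T : Rbar) (rho : R) :
  filterlim f (at_right 0) (locally (f 0)) ->
  (forall t, 0 < t -> Rbar_lt t T -> ex_derive f t) ->
  (forall t, 0 < t -> Rbar_lt t T -> f t <= rho -> Derive f t <= 0) ->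
  f 0 < rho ->
  forall t, 0 <= t -> Rbar_lt t T -> f t < rho.
Proof.
intros Hlim Hex Hneg H0 t1 Ht1 HT.
destruct (Rlt_le_dec (f t1) rho) as [H|Hbad]; [exact H|exfalso].
assert (Hlt : forall u, u <= t1 -> Rbar_lt u T).
{ intros u Hu. apply Rbar_le_lt_trans with t1; assumption. }
set (E := fun s => 0 <= s <= t1 /\ forall u, 0 <= u <= s -> f u < rho).
assert (HE0 : E 0).
{ split; [lra|]. intros u Hu. replace u with 0 by lra. exact H0. }
destruct (completeness E) as [s [Hub Hlub]].
- exists t1. intros u [Hu _]. lra.
- exists 0. exact HE0.
- (* [s] is the first time at which [f] is not below [rho] *)
  assert (Hs0 : 0 <= s) by (apply Hub; exact HE0).
  assert (Hst : s <= t1) by (apply Hlub; intros u [Hu _]; lra).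
  assert (Hbefore : forall u, 0 <= u < s -> f u < rho).
  { intros u Hu.
    destruct (Rlt_le_dec (f u) rho) as [H|H]; [exact H|exfalso].
    assert (s <= u); [|lra].
    apply Hlub. intros e [He1 He2].
    destruct (Rle_lt_dec e u) as [Heu|Heu]; [exact Heu|].
    assert (f u < rho) by (apply He2; lra). lra. }
  assert (Hat : rho <= f s).
  { destruct (Rle_lt_dec rho (f s)) as [H|H]; [exact H|exfalso].
    assert (Hst' : s < t1).
    { destruct Hst as [Hst|Hst]; [exact Hst|subst s; lra]. }
    assert (Hright : at_right s (fun u => f u < rho)).
    { assert (Hc : filterlim f (at_right s) (locally (f s))).
      { destruct Hs0 as [Hs0|Hs0].
        - eapply filterlim_filter_le_1; [apply filter_le_within|].
          apply (ex_derive_continuous f s). apply Hex; [exact Hs0|apply Hlt; lra].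
        - rewrite <- Hs0. exact Hlim. }
      apply (Hc (fun v => v < rho)). apply (open_lt rho). exact H. }
    destruct Hright as [d Hd].
    pose proof (cond_pos d) as Hdpos.
    set (e := Rmin t1 (s + d / 2)).
    assert (He : s < e <= t1 /\ e <= s + d / 2).
    { unfold e. repeat split; [apply Rmin_glb_lt; lra|apply Rmin_l|apply Rmin_r]. }
    assert (E e).
    { split; [lra|]. intros u Hu.
      destruct (Rtotal_order u s) as [Hus|[Hus|Hus]].
      - apply Hbefore; lra.
      - rewrite Hus. exact H.
      - apply Hd; [|exact Hus].
        apply Rabs_def1; unfold minus, plus, opp; simpl; lra. }
    assert (e <= s) by (apply Hub; assumption). lra. }
  assert (Hspos : 0 < s).
  { destruct Hs0 as [Hs0|Hs0]; [exact Hs0|]. rewrite <- Hs0 in Hat. lra. }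
  assert (f s <= f 0); [|lra].
  apply nonincreasing_from_right_limit; [exact Hspos|exact Hlim| |].
  + intros t Ht. apply Hex; [lra|apply Hlt; lra].
  + intros t Ht. apply Hneg; [lra|apply Hlt; lra|].
    left. apply Hbefore. lra.
Qed.

(** Once [f] is trapped below [rho] the decay inequality holds at all times,
    and [f t * exp (c * t)] is nonincreasing. *)
Lemma exponential_decay_below_level (f : R -> R) (T : Rbar) (rho c : R) :
  0 <= c ->
  (forall t, 0 <= f t) ->
  filterlim f (at_right 0) (locally (f 0)) ->
  (forall t, 0 < t -> Rbar_lt t T -> ex_derive f t) ->
  (forall t, 0 < t -> Rbar_lt t T -> f t <= rho -> Derive f t <= - c * f t) ->
  f 0 < rho ->
  forall t, 0 <= t -> Rbar_lt t T -> f t <= f 0 * exp (- (c * t)).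
Proof.
intros Hc Hnn Hlim Hex Hdec H0 t Ht HT.
assert (Htrap : forall u, 0 <= u -> Rbar_lt u T -> f u < rho).
{ apply trapped_below_level; try assumption.
  intros u Hu HuT Hr. specialize (Hdec u Hu HuT Hr). specialize (Hnn u). nra. }
destruct Ht as [Ht|Ht].
2:{ rewrite <- Ht, Rmult_0_r, Ropp_0, exp_0. lra. }
assert (Hlt : forall u, u <= t -> Rbar_lt u T).
{ intros u Hu. apply Rbar_le_lt_trans with t; assumption. }
set (g := fun u => f u * exp (c * u)).
assert (Hg : forall u, 0 < u <= t ->
  is_derive g u ((Derive f u + c * f u) * exp (c * u))).
{ intros u Hu. unfold g. auto_derive.
  - apply Hex; [lra|apply Hlt; lra].
  - change (Derive (fun x => f x) u) with (Derive f u). ring. }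
assert (Hgt : g t <= g 0).
{ apply nonincreasing_from_right_limit; [exact Ht| | |].
  - unfold g. eapply filterlim_comp_2.
    + exact Hlim.
    + eapply filterlim_filter_le_1; [apply filter_le_within|].
      apply (ex_derive_continuous (fun u => exp (c * u)) 0). auto_derive; trivial.
    + apply (filterlim_mult (f 0) (exp (c * 0))).
  - intros u Hu. eexists. apply Hg, Hu.
  - intros u Hu. rewrite (is_derive_unique _ _ _ (Hg u ltac:(lra))).
    assert (Derive f u <= - c * f u).
    { apply Hdec; [lra|apply Hlt; lra|]. left. apply Htrap; [lra|apply Hlt; lra]. }
    pose proof (exp_pos (c * u)). nra. }
unfold g in Hgt. rewrite Rmult_0_r, exp_0, Rmult_1_r in Hgt.
rewrite exp_Ropp.
apply Rmult_le_reg_r with (exp (c * t)); [apply exp_pos|].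
rewrite Rmult_assoc, Rinv_l, Rmult_1_r; [exact Hgt|].
apply Rgt_not_eq, exp_pos.
Qed.

(** * Lyapunov's direct method *)

(** [L] is required to decay only along curves with velocity [F], and only on
    the sublevel set [L <= rho].  The bound from below by the squared norm
    turns decay of [L] into decay of the distance to [s]; continuity of [L] at
    [s] makes [L (x 0)] small for [x 0] close to [s], and continuity elsewhere
    carries right-continuity of [x] at [0] over to [L]. *)
Lemma lyapunov_exponential {V : NormedModule R_AbsRing} (F : V -> V) (s : V)
    (L : V -> R) (k rho c : R) :
  0 < k -> 0 < rho -> 0 < c ->
  (forall z, k * norm (minus z s) ^ 2 <= L z) ->
  L s = 0 ->
  (forall z, continuous L z) ->
  (forall (x : R -> V) t, is_derive x t (F (x t)) ->
     exists l, is_derive (fun u => L (x u)) t l /\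
               (L (x t) <= rho -> l <= - c * L (x t))) ->
  locally_asymptotically_stable F s.
Proof.
intros Hk Hrho Hc Hlow HLs Hcont Hdec.
assert (Hnn : forall z, 0 <= L z).
{ intros z. eapply Rle_trans; [|apply Hlow].
  apply Rmult_le_pos; [lra|apply pow2_ge_0]. }
assert (Hexp : forall T x, is_solution F T x -> L (x 0) < rho ->
  forall t, 0 <= t -> Rbar_lt t T ->
  L (x t) <= L (x 0) * exp (- (c * t))).
{ intros T x [Hx0 Hx] HL0.
  apply (exponential_decay_below_level (fun u => L (x u)) T rho c);
    [lra|intros; apply Hnn| | | |exact HL0].
  - apply (filterlim_comp _ _ _ x L _ (locally (x 0))); [exact Hx0|apply Hcont].
  - intros t Ht HT. destruct (Hdec x t (Hx t Ht HT)) as [l [Hl _]].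
    exists l. exact Hl.
  - intros t Ht HT HL. destruct (Hdec x t (Hx t Ht HT)) as [l [Hl Hle]].
    replace (Derive _ t) with l; [apply Hle, HL|].
    symmetry. apply is_derive_unique. exact Hl. }
assert (Hsmall : forall r, 0 < r -> exists delta, 0 < delta /\
  forall z, norm (minus z s) < delta -> L z < r).
{ intros r Hr.
  assert (Hloc : locally s (fun z => L z < r)).
  { apply (Hcont s (fun v => v < r)). rewrite HLs. apply (open_lt r). exact Hr. }
  apply locally_norm_le_locally in Hloc. destruct Hloc as [d Hd].
  exists d. split; [apply cond_pos|]. intros z Hz. apply Hd. exact Hz. }
assert (Hnorm : forall eta z, 0 < eta -> L z < k * eta ^ 2 ->
  norm (minus z s) < eta).
{ intros eta z Heta HL. specialize (Hlow z).
  assert (0 <= norm (minus z s)) by apply norm_ge_0.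
  destruct (Rlt_le_dec (norm (minus z s)) eta) as [H1|H1]; [exact H1|exfalso].
  assert (eta ^ 2 <= norm (minus z s) ^ 2) by (apply pow_incr; lra). nra. }
split.
- intros eta Heta.
  assert (Hke : 0 < k * eta ^ 2) by (apply Rmult_lt_0_compat; [lra|apply pow_lt, Heta]).
  destruct (Hsmall (Rmin rho (k * eta ^ 2))) as [d [Hd Hin]].
  { apply Rmin_glb_lt; assumption. }
  exists d. split; [exact Hd|]. intros T x Hx H0 t Ht HT.
  specialize (Hin _ H0).
  pose proof (Rmin_l rho (k * eta ^ 2)). pose proof (Rmin_r rho (k * eta ^ 2)).
  apply Hnorm; [exact Heta|].
  eapply Rle_lt_trans; [apply (Hexp T x Hx ltac:(lra) t Ht HT)|].
  assert (exp (- (c * t)) <= 1).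
  { rewrite <- exp_0. destruct Ht as [Ht|Ht].
    - left. apply exp_increasing. nra.
    - right. f_equal. rewrite <- Ht. ring. }
  specialize (Hnn (x 0)). pose proof (exp_pos (- (c * t))). nra.
- destruct (Hsmall rho Hrho) as [d [Hd Hin]].
  exists d. split; [exact Hd|]. intros x Hx H0.
  specialize (Hin _ H0).
  intros P HP. apply locally_norm_le_locally in HP. destruct HP as [eta HP].
  assert (Hke : 0 < k * eta ^ 2)
    by (apply Rmult_lt_0_compat; [lra|apply pow_lt, cond_pos]).
  (* from then on [exp (c * t) > 1 + c * t > L (x 0) / (k * eta ^ 2)] *)
  exists (Rmax 0 (L (x 0) / (k * eta ^ 2) / c)). intros t Ht.
  assert (Ht0 : 0 < t) by (eapply Rle_lt_trans; [apply Rmax_l|exact Ht]).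
  assert (Ht1 : L (x 0) / (k * eta ^ 2) / c < t)
    by (eapply Rle_lt_trans; [apply Rmax_r|exact Ht]).
  apply HP. apply Hnorm; [apply cond_pos|].
  eapply Rle_lt_trans; [apply (Hexp p_infty x Hx Hin t ltac:(lra) I)|].
  rewrite exp_Ropp.
  apply Rmult_lt_reg_r with (exp (c * t)); [apply exp_pos|].
  rewrite Rmult_assoc, Rinv_l, Rmult_1_r by (apply Rgt_not_eq, exp_pos).
  apply Rlt_trans with (k * eta ^ 2 * (1 + c * t)).
  + apply (Rlt_div_l _ _ _ Hc) in Ht1.
    apply (proj1 (Rlt_div_l _ _ _ Hke)) in Ht1. nra.
  + apply Rmult_lt_compat_l; [exact Hke|]. apply exp_ineq1. nra.
Qed.
(** * A quadratic Lyapunov function for the cascade *)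

Definition diag_quadratic (A B D x v y w : R) : R :=
  y ^ 2 + A * x ^ 2 + B * v ^ 2 + D * w ^ 2.

Lemma mult_le_weighted_squares (g K a b : R) :
  0 < K -> g * a * b <= K / 4 * b ^ 2 + g ^ 2 / K * a ^ 2.
Proof.
intros HK.
assert (H : K / 4 * b ^ 2 + g ^ 2 / K * a ^ 2 - g * a * b
            = (K / 2 * b - g * a) ^ 2 / K) by (field; lra).
assert (0 <= (K / 2 * b - g * a) ^ 2 / K)
  by (apply Rdiv_le_0_compat; [apply pow2_ge_0|exact HK]).
lra.
Qed.

(** The left-hand side of the decay estimate is the derivative of the form along
    the cascade.  The weights are fixed from the bottom of the cascade upwards:
    [A] absorbs the term [q x y] left over from [y'], then [B] absorbs
    [A p v x], and [D] absorbs [G w y] and part of [l x (w - y) y].  The level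
    [rho = d ^ 2] then bounds [x] and [v] by [d], because [A] and [B] are at
    least [1], and [d] is small enough for the terms of degree three to cost
    only a fraction of the damping. *)
Lemma cascade_quadratic_decay (k K eps b l p q G : R) :
  0 < k -> 0 < K -> 0 < eps -> 0 <= b -> 0 <= l ->
  exists A B D rho c : R,
    1 <= A /\ 1 <= B /\ 1 <= D /\ 0 < rho /\ 0 < c /\
    forall x v y w : R,
      diag_quadratic A B D x v y w <= rho ->
      2 * (y * (- K * y + G * w + q * x + l * x * (w - y))
           + A * (x * (- k * x - b * x ^ 2 + p * v + b * x * v))
           + B * (v * (- eps * v)) + D * (w * (- eps * w)))
      <= - c * diag_quadratic A B D x v y w.
Proof.
intros Hk HK Heps Hb Hl.
assert (Hq : 0 <= q ^ 2 / K) by (apply Rdiv_le_0_compat; [apply pow2_ge_0|exact HK]).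
assert (Hp : 0 <= p ^ 2 / k) by (apply Rdiv_le_0_compat; [apply pow2_ge_0|exact Hk]).
assert (HG : 0 <= G ^ 2 / K) by (apply Rdiv_le_0_compat; [apply pow2_ge_0|exact HK]).
(* [q ^ 2 / K], [p ^ 2 / k] and [G ^ 2 / K] are what completing squares against
   [K y ^ 2] and [k x ^ 2] leaves on the upstream variables *)
set (A := 1 + 4 * (q ^ 2 / K) / k).
set (B := 1 + 2 * (A * (p ^ 2 / k)) / eps).
set (D := 1 + 2 * (G ^ 2 / K + K / 12) / eps).
set (d := / (1 + 6 * l / K + 8 * b / k)).
set (c := Rmin (Rmin (K / 2) (k / 2)) eps).
assert (HA : 1 <= A).
{ assert (0 <= 4 * (q ^ 2 / K) / k) by (apply Rdiv_le_0_compat; lra).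
  unfold A. lra. }
assert (HAk : A * k = k + 4 * (q ^ 2 / K)) by (unfold A; field; lra).
assert (HB : 1 <= B).
{ assert (0 <= 2 * (A * (p ^ 2 / k)) / eps) by (apply Rdiv_le_0_compat; nra).
  unfold B. lra. }
assert (HBe : B * eps = eps + 2 * (A * (p ^ 2 / k))) by (unfold B; field; lra).
assert (HD : 1 <= D).
{ assert (0 <= 2 * (G ^ 2 / K + K / 12) / eps) by (apply Rdiv_le_0_compat; lra).
  unfold D. lra. }
assert (HDe : D * eps = eps + 2 * (G ^ 2 / K + K / 12)) by (unfold D; field; lra).
assert (Hl' : 0 <= 6 * l / K) by (apply Rdiv_le_0_compat; lra).
assert (Hb' : 0 <= 8 * b / k) by (apply Rdiv_le_0_compat; lra).
assert (Hd : 0 < d) by (apply Rinv_0_lt_compat; lra).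
assert (Hd1 : d * (1 + 6 * l / K + 8 * b / k) = 1) by (apply Rinv_l; lra).
assert (Hld : l * d <= K / 6).
{ assert (E : l = K / 6 * (6 * l / K)) by (field; lra). rewrite E. nra. }
assert (Hbd : b * d <= k / 8).
{ assert (E : b = k / 8 * (8 * b / k)) by (field; lra). rewrite E. nra. }
assert (Hc : 0 < c) by (unfold c; repeat apply Rmin_glb_lt; lra).
assert (HcK : c <= K / 2)
  by (unfold c; eapply Rle_trans; [apply Rmin_l|apply Rmin_l]).
assert (Hck : c <= k / 2)
  by (unfold c; eapply Rle_trans; [apply Rmin_l|apply Rmin_r]).
assert (Hce : c <= eps) by apply Rmin_r.
exists A, B, D, (d ^ 2), c.
repeat (split; [first [assumption | apply pow_lt; assumption]|]).
intros x v y w HL. unfold diag_quadratic in *.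
pose proof (pow2_ge_0 x) as Hx2. pose proof (pow2_ge_0 v) as Hv2.
pose proof (pow2_ge_0 y) as Hy2. pose proof (pow2_ge_0 w) as Hw2.
assert (Hbound : forall z, z ^ 2 <= d ^ 2 -> - d <= z <= d)
  by (intros z Hz; split; nra).
assert (Hx : - d <= x <= d) by (apply Hbound; nra).
assert (Hv : - d <= v <= d) by (apply Hbound; nra).
pose proof (mult_le_weighted_squares G K w y HK) as T1.
pose proof (mult_le_weighted_squares q K x y HK) as T2.
pose proof (mult_le_weighted_squares p k v x Hk) as T3.
assert (T4 : l * x * (w - y) * y <= K / 6 * (3 / 2 * y ^ 2 + / 2 * w ^ 2)).
{ set (S := 3 / 2 * y ^ 2 + / 2 * w ^ 2).
  set (z := (w - y) * y).
  assert (HS : 0 <= S) by (unfold S; lra).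
  assert (Hz1 : - S <= z).
  { unfold S, z. pose proof (pow2_ge_0 (w + y)). nra. }
  assert (Hz2 : z <= S).
  { unfold S, z. pose proof (pow2_ge_0 (w - y)). nra. }
  assert (Hxz : x * z <= d * S).
  { pose proof (Rmult_le_pos (d - x) (S + z) ltac:(lra) ltac:(lra)).
    pose proof (Rmult_le_pos (d + x) (S - z) ltac:(lra) ltac:(lra)). lra. }
  replace (l * x * (w - y) * y) with (l * (x * z)) by (unfold z; ring).
  pose proof (Rmult_le_compat_l l _ _ Hl Hxz).
  pose proof (Rmult_le_compat_r S _ _ HS Hld). lra. }
assert (T5 : b * (x ^ 2 * (v - x)) <= k / 4 * x ^ 2).
{ assert (Hvx : x ^ 2 * (v - x) <= x ^ 2 * (2 * d))
    by (apply Rmult_le_compat_l; lra).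
  pose proof (Rmult_le_compat_l b _ _ Hb Hvx).
  pose proof (Rmult_le_compat_r (x ^ 2) _ _ Hx2 Hbd). lra. }
assert (TA : A * (p * v * x + b * (x ^ 2 * (v - x)))
             <= A * (k / 2 * x ^ 2 + p ^ 2 / k * v ^ 2))
  by (apply Rmult_le_compat_l; lra).
assert (Ey : c * y ^ 2 <= K / 2 * y ^ 2) by (apply Rmult_le_compat_r; lra).
assert (Ex : c * (A * x ^ 2) <= k / 2 * (A * x ^ 2))
  by (apply Rmult_le_compat_r; [nra|lra]).
assert (Ev : c * (B * v ^ 2) <= eps * (B * v ^ 2))
  by (apply Rmult_le_compat_r; [nra|lra]).
assert (Ew : c * (D * w ^ 2) <= eps * (D * w ^ 2))
  by (apply Rmult_le_compat_r; [nra|lra]).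
replace (k / 2 * (A * x ^ 2)) with (A * k * / 2 * x ^ 2) in Ex by field.
replace (eps * (B * v ^ 2)) with (B * eps * v ^ 2) in Ev by ring.
replace (eps * (D * w ^ 2)) with (D * eps * w ^ 2) in Ew by ring.
apply Rle_trans with
  (2 * (- K * y ^ 2 + G * w * y + q * x * y + l * x * (w - y) * y
        - A * k * x ^ 2 + A * (p * v * x + b * (x ^ 2 * (v - x)))
        - B * eps * v ^ 2 - D * eps * w ^ 2)); [right; ring|].
assert (TA' : A * (k / 2 * x ^ 2 + p ^ 2 / k * v ^ 2)
  = A * k / 2 * x ^ 2 + A * (p ^ 2 / k) * v ^ 2) by (field; lra).
rewrite TA' in TA. rewrite HAk in *. rewrite HBe in *. rewrite HDe in *.
nra.
Qed.

(** * Calculus on the state space *)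

Lemma is_derive_fst {U W : NormedModule R_AbsRing} (x : R -> U * W) (t : R) (l : U * W) :
  is_derive x t l -> is_derive (fun u => fst (x u)) t (fst l).
Proof.
intros H.
apply (filterdiff_ext_lin _ (fun y : R => fst (scal y l))); [|reflexivity].
apply (filterdiff_comp x fst (fun y : R => scal y l) fst H).
apply filterdiff_linear, is_linear_fst.
Qed.

Lemma is_derive_snd {U W : NormedModule R_AbsRing} (x : R -> U * W) (t : R) (l : U * W) :
  is_derive x t l -> is_derive (fun u => snd (x u)) t (snd l).
Proof.
intros H.
apply (filterdiff_ext_lin _ (fun y : R => snd (scal y l))); [|reflexivity].
apply (filterdiff_comp x snd (fun y : R => scal y l) snd H).
apply filterdiff_linear, is_linear_snd.
Qed.

Lemma is_derive_state (x : R -> state) (t dr dc dpr dpc : R) :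
  is_derive x t ((dr, dc, dpr, dpc) : state) ->
  is_derive (fun u => fst (fst (fst (x u)))) t dr /\
  is_derive (fun u => snd (fst (fst (x u)))) t dc /\
  is_derive (fun u => snd (fst (x u))) t dpr /\
  is_derive (fun u => snd (x u)) t dpc.
Proof.
intros H.
pose proof (is_derive_fst x t _ H) as H1.
pose proof (is_derive_fst _ t _ H1) as H2.
split; [|split; [|split]].
- exact (is_derive_fst _ t _ H2).
- exact (is_derive_snd _ t _ H2).
- exact (is_derive_snd _ t _ H1).
- exact (is_derive_snd _ t _ H).
Qed.

Lemma constant_solution_iff_zero (F : state -> state) (s : state) :
  is_solution F p_infty (fun _ => s) <-> F s = (0, 0, 0, 0).
Proof.
split.
- intros [_ H]. specialize (H 1 Rlt_0_1 I).
  destruct (F s) as [[[dr dc] dpr] dpc].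
  apply is_derive_state in H. destruct H as [H1 [H2 [H3 H4]]].
  apply is_derive_unique in H1, H2, H3, H4.
  rewrite Derive_const in H1, H2, H3, H4. congruence.
- intros H. split.
  + apply filterlim_const.
  + intros t _ _. rewrite H. exact (is_derive_const (K := R_AbsRing) s t).
Qed.

Lemma norm_state_sq (r c pr pc : R) :
  norm ((r, c, pr, pc) : state) ^ 2 = r ^ 2 + c ^ 2 + pr ^ 2 + pc ^ 2.
Proof.
assert (Hprod : forall (U W : NormedModule R_AbsRing) (u : U) (w : W),
  norm ((u, w) : prod_NormedModule R_AbsRing U W) ^ 2 = norm u ^ 2 + norm w ^ 2).
{ intros U W u w. apply pow2_sqrt.
  apply Rplus_le_le_0_compat; apply pow2_ge_0. }
assert (Habs : forall v : R, norm v ^ 2 = v ^ 2) by (intros v; apply pow2_abs).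
change (norm ((r, c, pr, pc) : state)) with
  (norm ((((r, c) : prod_NormedModule _ R_NormedModule R_NormedModule, pr)
            : prod_NormedModule _ _ R_NormedModule, pc)
            : prod_NormedModule _ _ R_NormedModule)).
rewrite !Hprod, !Habs. reflexivity.
Qed.

Lemma continuous_state_coordinates (z : state) :
  continuous (fun z : state => fst (fst (fst z))) z /\
  continuous (fun z : state => snd (fst (fst z))) z /\
  continuous (fun z : state => snd (fst z)) z /\
  continuous (fun z : state => snd z) z.
Proof.
destruct z as [[[r c] pr] pc].
assert (H1 : continuous (fun z : state => fst z) (r, c, pr, pc))
  by apply continuous_fst.
assert (H2 : continuous (fun z : state => fst (fst z)) (r, c, pr, pc))
  by (apply (continuous_comp (fun z : state => fst z) fst); [exact H1|apply continuous_fst]).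
split; [|split; [|split]].
- apply (continuous_comp (fun z : state => fst (fst z)) fst); [exact H2|apply continuous_fst].
- apply (continuous_comp (fun z : state => fst (fst z)) snd); [exact H2|apply continuous_snd].
- apply (continuous_comp (fun z : state => fst z) snd); [exact H1|apply continuous_snd].
- apply continuous_snd.
Qed.

Lemma is_derive_diag_quadratic (A B D : R) (x v y w : R -> R) (t dx dv dy dw : R) :
  is_derive x t dx -> is_derive v t dv -> is_derive y t dy -> is_derive w t dw ->
  is_derive (fun u => diag_quadratic A B D (x u) (v u) (y u) (w u)) t
    (2 * (y t * dy + A * (x t * dx) + B * (v t * dv) + D * (w t * dw))).
Proof.
intros Hx Hv Hy Hw. unfold diag_quadratic. auto_derive.
- repeat split; eexists; eassumption.
- replace (Derive (fun x0 => x x0) t) with dx by (symmetry; apply is_derive_unique, Hx).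
  replace (Derive (fun x0 => v x0) t) with dv by (symmetry; apply is_derive_unique, Hv).
  replace (Derive (fun x0 => y x0) t) with dy by (symmetry; apply is_derive_unique, Hy).
  replace (Derive (fun x0 => w x0) t) with dw by (symmetry; apply is_derive_unique, Hw).
  ring.
Qed.

Lemma continuous_diag_quadratic {U : UniformSpace} (A B D : R) (x v y w : U -> R) (z : U) :
  continuous x z -> continuous v z -> continuous y z -> continuous w z ->
  continuous (fun u => diag_quadratic A B D (x u) (v u) (y u) (w u)) z.
Proof.
intros Hx Hv Hy Hw.
assert (Hterm : forall (k : R) (f : U -> R), continuous f z ->
  continuous (fun u => k * f u ^ 2) z).
{ intros k f Hf. apply (continuous_comp f (fun r => k * r ^ 2)); [exact Hf|].
  apply (ex_derive_continuous (fun r => k * r ^ 2)). auto_derive. exact I. }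
unfold diag_quadratic.
apply (continuous_plus (fun u => y u ^ 2 + A * x u ^ 2 + B * v u ^ 2)
                       (fun u => D * w u ^ 2)); [|apply Hterm, Hw].
apply (continuous_plus (fun u => y u ^ 2 + A * x u ^ 2)
                       (fun u => B * v u ^ 2)); [|apply Hterm, Hv].
apply (continuous_plus (fun u => y u ^ 2) (fun u => A * x u ^ 2)); [|apply Hterm, Hx].
apply continuous_ext with (fun u => 1 * y u ^ 2); [intros; apply Rmult_1_l|].
apply Hterm, Hy.
Qed.

(** * The system for [lambda5 = lambda7 = 0] *)

(** The inflows are written
    [eps * u0] and [eps * w0], so that [u0] and [w0] are the limits of
    [R + P_R] and [C + P_C]. *)
Definition uncoupled_field (eps beta1 beta2 a b g l u0 w0 : R) (s : state) : state :=
  let '(r, c, pr, pc) := s in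
  (- (eps + beta2) * r + (a + b * r) * pr,
   - (eps + beta1) * c + (g + l * r) * pc,
   eps * u0 + beta2 * r - (eps + a + b * r) * pr,
   eps * w0 + beta1 * c - (eps + g + l * r) * pc).

Lemma uncoupled_field_zero_iff (eps beta1 beta2 a b g l u0 w0 r c pr pc : R) :
  0 < eps ->
  uncoupled_field eps beta1 beta2 a b g l u0 w0 (r, c, pr, pc) = (0, 0, 0, 0) <->
  pr = u0 - r /\ pc = w0 - c /\
  (a + b * r) * (u0 - r) = (eps + beta2) * r /\
  (eps + beta1 + g + l * r) * c = (g + l * r) * w0.
Proof.
intros Heps. unfold uncoupled_field. split.
- intros H. injection H as H1 H2 H3 H4.
  assert (Hpr : pr = u0 - r) by (apply Rmult_eq_reg_l with eps; lra).
  assert (Hpc : pc = w0 - c) by (apply Rmult_eq_reg_l with eps; lra).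
  rewrite Hpr in H1. rewrite Hpc in H2. repeat split; try assumption; lra.
- intros (-> & -> & H1 & H2). repeat f_equal; lra.
Qed.

(** The two positivity assumptions are the damping rates [k] and [K] of the
    cascade.  The factor [/ 3] below comes from
    [(v - x)^2 <= 2 v^2 + 2 x^2], as [v - x] and [w - y] are the deviations of
    [P_R] and [P_C]. *)
Lemma uncoupled_field_stable (F : state -> state)
    (eps beta1 beta2 a b g l u0 w0 r0 c0 : R) :
  (forall s, F s = uncoupled_field eps beta1 beta2 a b g l u0 w0 s) ->
  0 < eps -> 0 <= b -> 0 <= l ->
  (a + b * r0) * (u0 - r0) = (eps + beta2) * r0 ->
  (eps + beta1 + g + l * r0) * c0 = (g + l * r0) * w0 ->
  0 < eps + beta2 + a + 2 * b * r0 - b * u0 ->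
  0 < eps + beta1 + g + l * r0 ->
  locally_asymptotically_stable F (r0, c0, u0 - r0, w0 - c0).
Proof.
intros HF Heps Hb Hl Hr0 Hc0 Hk HK.
destruct (cascade_quadratic_decay
  (eps + beta2 + a + 2 * b * r0 - b * u0) (eps + beta1 + g + l * r0) eps b l
  (a + b * r0) (l * (w0 - c0)) (g + l * r0) Hk HK Heps Hb Hl)
  as (A & B & D & rho & c & HA & HB & HD & Hrho & Hc & Hdecay).
pose (X := fun z : state => fst (fst (fst z)) - r0).
pose (Y := fun z : state => snd (fst (fst z)) - c0).
pose (V := fun z : state => fst (fst (fst z)) + snd (fst z) - u0).
pose (W := fun z : state => snd (fst (fst z)) + snd z - w0).
apply (lyapunov_exponential F _
  (fun z => diag_quadratic A B D (X z) (V z) (Y z) (W z)) (/ 3) rho c);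
  [lra|exact Hrho|exact Hc| | | |].
- intros [[[r c1] pr] pc].
  change (minus _ _) with ((r - r0, c1 - c0, pr - (u0 - r0), pc - (w0 - c0)) : state).
  rewrite norm_state_sq. unfold diag_quadratic, X, V, Y, W; simpl fst; simpl snd.
  set (x := r - r0). set (y := c1 - c0).
  set (v := r + pr - u0). set (w := c1 + pc - w0).
  replace (pr - (u0 - r0)) with (v - x) by (unfold v, x; ring).
  replace (pc - (w0 - c0)) with (w - y) by (unfold w, y; ring).
  pose proof (pow2_ge_0 (v + x)). pose proof (pow2_ge_0 (w + y)).
  pose proof (Rmult_le_compat_r (x ^ 2) _ _ (pow2_ge_0 x) HA).
  pose proof (Rmult_le_compat_r (v ^ 2) _ _ (pow2_ge_0 v) HB).
  pose proof (Rmult_le_compat_r (w ^ 2) _ _ (pow2_ge_0 w) HD).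
  pose proof (pow2_ge_0 v). pose proof (pow2_ge_0 w).
  lra.
- unfold diag_quadratic, X, V, Y, W; simpl fst; simpl snd. ring.
- intros z. destruct (continuous_state_coordinates z) as (H1 & H2 & H3 & H4).
  assert (Hsub : forall (k : R) (f : state -> R), continuous f z ->
    continuous (fun u => f u - k) z).
  { intros k f Hf. apply (continuous_minus f (fun _ => k)); [exact Hf|].
    apply continuous_const. }
  apply continuous_diag_quadratic; apply Hsub; try assumption.
  + apply (continuous_plus (fun z : state => fst (fst (fst z)))
                           (fun z : state => snd (fst z))); assumption.
  + apply (continuous_plus (fun z : state => snd (fst (fst z)))
                           (fun z : state => snd z)); assumption.
- intros x t Hx. rewrite HF in Hx.
  unfold uncoupled_field in Hx.
  remember (x t) as z eqn:Hz.
  destruct z as [[[r c1] pr] pc].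
  apply is_derive_state in Hx. destruct Hx as (Hr & Hc1 & Hpr & Hpc).
  assert (Hsub : forall (f : R -> R) (k d e : R), is_derive f t d -> d = e ->
    is_derive (fun u => f u - k) t e).
  { intros f k d e Hf <-. replace d with (minus d 0) by apply Rminus_0_r.
    apply (is_derive_minus f (fun _ => k)); [exact Hf|exact (is_derive_const k t)]. }
  set (x1 := r - r0). set (v1 := r + pr - u0).
  set (y1 := c1 - c0). set (w1 := c1 + pc - w0).
  assert (HX : is_derive (fun u => X (x u)) t
    (- (eps + beta2 + a + 2 * b * r0 - b * u0) * x1 - b * x1 ^ 2
     + (a + b * r0) * v1 + b * x1 * v1)).
  { apply (Hsub _ _ _ _ Hr). unfold x1, v1. lra. }
  assert (HV : is_derive (fun u => V (x u)) t (- eps * v1)).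
  { apply (Hsub _ _ _ _ (is_derive_plus _ _ _ _ _ Hr Hpr)).
    unfold plus, v1; simpl. ring. }
  assert (HY : is_derive (fun u => Y (x u)) t
    (- (eps + beta1 + g + l * r0) * y1 + (g + l * r0) * w1
     + l * (w0 - c0) * x1 + l * x1 * (w1 - y1))).
  { apply (Hsub _ _ _ _ Hc1). unfold x1, y1, w1. lra. }
  assert (HW : is_derive (fun u => W (x u)) t (- eps * w1)).
  { apply (Hsub _ _ _ _ (is_derive_plus _ _ _ _ _ Hc1 Hpc)).
    unfold plus, w1; simpl. ring. }
  eexists. split.
  + exact (is_derive_diag_quadratic A B D _ _ _ _ t _ _ _ _ HX HV HY HW).
  + cbv beta. rewrite <- Hz. exact (Hdecay x1 v1 y1 w1).
Qed.

(** Writing [S] for the square root, the difference of the two sides of the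
    equation factors as [b (S - (r - mid)) (S + (r - mid))] with
    [mid = u / 2 - theta], and [S ^ 2 = mid ^ 2 + u a / b].  So [S > |mid|] if
    [u > 0], while [mid = - theta < 0] if [u = 0]; either way the other root
    [mid - S] is negative. *)
Lemma nonneg_root_characterization (a b d u : R) :
  0 < a -> 0 < b -> 0 < d -> 0 <= u ->
  let theta := (a + d) / (2 * b) in
  let r := u / 2 - theta + sqrt ((u / 2 + theta) ^ 2 - u * d / b) in
  0 <= r <= u /\ (a + b * r) * (u - r) = d * r /\
  0 < d + a + 2 * b * r - b * u /\
  (forall r', 0 <= r' -> (a + b * r') * (u - r') = d * r' -> r' = r).
Proof.
intros Ha Hb Hd Hu theta r.
assert (Htheta : 0 < theta) by (apply Rdiv_lt_0_compat; lra).
assert (Hbt : 2 * b * theta = a + d) by (unfold theta; field; lra).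
assert (Hau : 0 <= u * a / b) by (apply Rdiv_le_0_compat; nra).
assert (Hdu : 0 <= u * d / b) by (apply Rdiv_le_0_compat; nra).
assert (Hbau : b * (u * a / b) = u * a) by (field; lra).
assert (Hdisc : (u / 2 + theta) ^ 2 - u * d / b = (u / 2 - theta) ^ 2 + u * a / b)
  by (unfold theta; field; lra).
assert (Hpos : 0 < (u / 2 - theta) ^ 2 + u * a / b).
{ destruct Hu as [Hu|<-].
  - assert (0 < u * a / b) by (apply Rdiv_lt_0_compat; nra).
    pose proof (pow2_ge_0 (u / 2 - theta)). lra.
  - nra. }
set (S := sqrt ((u / 2 + theta) ^ 2 - u * d / b)).
assert (HS : 0 < S) by (apply sqrt_lt_R0; lra).
assert (HS2 : S ^ 2 = (u / 2 - theta) ^ 2 + u * a / b).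
{ unfold S. rewrite pow2_sqrt; lra. }
change r with (u / 2 - theta + S) in *. clearbody S. clear r.
assert (HbS2 : b * S ^ 2 = b * (u / 2 - theta) ^ 2 + u * a)
  by (rewrite HS2, Rmult_plus_distr_l, Hbau; reflexivity).
assert (Hfactor : forall z, (a + b * z) * (u - z) - d * z
  = b * ((S - (z - (u / 2 - theta))) * (S + (z - (u / 2 - theta))))).
{ intros z. replace d with (2 * b * theta - a) by lra.
  transitivity (b * S ^ 2 - b * (z - (u / 2 - theta)) ^ 2); [|ring].
  rewrite HbS2. field. }
split; [split|split; [|split]].
- nra.
- nra.
- pose proof (Hfactor (u / 2 - theta + S)). nra.
- replace (d + a) with (2 * b * theta) by lra. nra.
- intros z Hz Hbal.
  assert (Hother : 0 < S + (z - (u / 2 - theta))).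
  { destruct Hu as [Hu|<-]; [|lra].
    assert (0 < u * a / b) by (apply Rdiv_lt_0_compat; nra). nra. }
  pose proof (Hfactor z) as Hz0. rewrite Hbal, Rminus_diag in Hz0.
  symmetry in Hz0. apply Rmult_integral in Hz0. destruct Hz0 as [Hz0|Hz0]; [lra|].
  apply Rmult_integral in Hz0. lra.
Qed.

Theorem theorem3
    (lambda1 lambda2 lambda3 lambda4 lambda5 lambda6 lambda7
     beta1 beta2 epsilon gamma m mR alpha : R)
    (Hlambda1 : 0 <= lambda1) (Hlambda2 : 0 <= lambda2)
    (Hlambda3 : 0 <= lambda3) (Hlambda4 : 0 <= lambda4)
    (Hlambda5 : 0 <= lambda5) (Hlambda6 : 0 <= lambda6)
    (Hlambda7 : 0 <= lambda7)
    (Hbeta1 : 0 <= beta1) (Hbeta2 : 0 <= beta2)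
    (Hepsilon : 0 <= epsilon) (Hgamma : 0 <= gamma)
    (Hm : 0 <= m) (HmR : 0 <= mR)
    (Halpha : 0 <= alpha <= 1)
    (Hepsilon_pos : 0 < epsilon) (Hlambda2_pos : 0 < lambda2)
    (Hpr : lambda3 + m * lambda4 <> 0)
    (Hpc : lambda1 + m * lambda4 <> 0)
    (Hlambda5_0 : lambda5 = 0) (Hlambda7_0 : lambda7 = 0) :
  let F := vector_field lambda1 lambda2 lambda3 lambda4 lambda5 lambda6 lambda7
             beta1 beta2 epsilon gamma m mR alpha in
  let theta :=
    (lambda3 + m * lambda4 + beta2 + epsilon)
    / (2 * (lambda2 + mR * lambda6)) in
  exists Rs Cs PRs PCs : R,
    unique (equilibrium F) (Rs, Cs, PRs, PCs) /\
    locally_asymptotically_stable F (Rs, Cs, PRs, PCs) /\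
    Rs = alpha * gamma / (2 * epsilon) - theta
         + sqrt ((alpha * gamma / (2 * epsilon) + theta) ^ 2
                 - alpha * gamma * (epsilon + beta2)
                   / (epsilon * (lambda2 + mR * lambda6))) /\
    Cs = (1 - alpha) * gamma * (lambda1 + m * lambda4 + lambda2 * Rs)
         / (epsilon * (epsilon + beta1 + lambda1 + m * lambda4
                       + lambda2 * Rs)) /\
    PRs = gamma * alpha / epsilon - Rs /\
    PCs = gamma * (1 - alpha) / epsilon - Cs.
Proof.
intros F theta.
set (a := lambda3 + m * lambda4) in *.
set (g := lambda1 + m * lambda4) in *.
set (b := lambda2 + mR * lambda6) in *.
set (u0 := alpha * gamma / epsilon).
set (w0 := (1 - alpha) * gamma / epsilon).
assert (Hml4 : 0 <= m * lambda4) by (apply Rmult_le_pos; assumption).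
assert (Ha : 0 < a) by (unfold a in *; lra).
assert (Hg : 0 < g) by (unfold g in *; lra).
assert (Hb : 0 < b).
{ assert (0 <= mR * lambda6) by (apply Rmult_le_pos; assumption). unfold b. lra. }
assert (Hd : 0 < epsilon + beta2) by lra.
assert (Hu0 : 0 <= u0) by (apply Rdiv_le_0_compat; [nra|lra]).
assert (Hw0 : 0 <= w0) by (apply Rdiv_le_0_compat; [nra|lra]).
assert (HF : forall s, F s =
  uncoupled_field epsilon beta1 beta2 a b g lambda2 u0 w0 s).
{ intros [[[r c] pr] pc]. unfold F, vector_field, uncoupled_field, u0, w0.
  rewrite Hlambda5_0, Hlambda7_0. fold a b.
  refine (f_equal2 pair (f_equal2 pair (f_equal2 pair _ _) _) _);
    unfold g, a, b; field; lra. }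
destruct (nonneg_root_characterization a b (epsilon + beta2) u0 Ha Hb Hd Hu0)
  as ([Hr_nn Hr_le] & Hr_bal & Hslope & Hr_uniq).
match type of Hr_nn with _ <= ?r => set (r0 := r) in * end.
assert (HK : 0 < epsilon + beta1 + g + lambda2 * r0) by nra.
set (c0 := (g + lambda2 * r0) * w0 / (epsilon + beta1 + g + lambda2 * r0)).
assert (Hc0 : (epsilon + beta1 + g + lambda2 * r0) * c0 = (g + lambda2 * r0) * w0)
  by (unfold c0; field; lra).
exists r0, c0, (u0 - r0), (w0 - c0).
split; [|split; [|split; [|split; [|split]]]].
- split.
  + split.
    * apply constant_solution_iff_zero. rewrite HF.
      apply uncoupled_field_zero_iff; auto.
    * assert (0 <= c0) by (apply Rdiv_le_0_compat; [apply Rmult_le_pos; nra|exact HK]).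
      assert (c0 <= w0) by nra.
      simpl. lra.
  + intros [[[r c] pr] pc] [Hsol (Hr & _)].
    apply constant_solution_iff_zero in Hsol. rewrite HF in Hsol.
    apply uncoupled_field_zero_iff in Hsol; [|exact Hepsilon_pos].
    destruct Hsol as (-> & -> & Hbal & Hcbal).
    rewrite (Hr_uniq r Hr Hbal) in *.
    replace c with c0; [reflexivity|].
    apply Rmult_eq_reg_l with (epsilon + beta1 + g + lambda2 * r0); lra.
- apply (uncoupled_field_stable F epsilon beta1 beta2 a b g lambda2 u0 w0 r0 c0);
    try assumption; lra.
- unfold r0, theta, u0.
  replace (alpha * gamma / epsilon / 2) with (alpha * gamma / (2 * epsilon)) by (field; lra).
  replace (alpha * gamma / epsilon * (epsilon + beta2) / b)
    with (alpha * gamma * (epsilon + beta2) / (epsilon * b)) by (field; lra).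
  replace (a + (epsilon + beta2)) with (a + beta2 + epsilon) by ring.
  reflexivity.
- unfold g in HK. unfold c0, w0, g. field. lra.
- unfold u0. field. lra.
- unfold w0. field. lra.
Qed.
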